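(* Let $n,d,m$ be positive integers. The family of algebraic graphs of complexity $(n,d,m)$ has the Erdős–Hajnal property.
   Context: All graphs are finite. A family of graphs $\mathcal{G}$ has the Erdős–Hajnal property if there exists a constant $c=c(\mathcal{G})>0$ such that every $G\in\mathcal{G}$ contains a clique or an independent set of size at least $|V(G)|^c$. A graph $G$ is algebraic of complexity $(n,d,m)$ if there is a field $\mathbb{F}$ such that $V(G)$ is a (finite) subset of $\mathbb{F}^n$, and there exist $m$ polynomials $f_1,\dots,f_m:(\mathbb{F}^n)^2\to\mathbb{F}$ of degree at most $d$ and a Boolean formula (function) $\phi:\{\text{false},\text{true}\}^m\to\{\text{false},\text{true}\}$ such that a pair $\{\mathbf{v}_1,\mathbf{v}_2\}$ of distinct vertices is an edge if and only if $\phi([f_1(\mathbf{v}_1,\mathbf{v}_2)=0],\dots,[f_m(\mathbf{v}_1,\mathbf{v}_2)=0])=\text{true}$. It is assumed that for distinct $\mathbf{v}_1,\mathbf{v}_2\in V(G)$ the left-hand side is invariant under swapping $\mathbf{v}_1$ and $\mathbf{v}_2$. The family includes such graphs over all fields $\mathbb{F}$. *)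

(* Defs.v *)
(* [mpoly] comes first and without its notations: it redefines [symmetric], and
   its notations clash with those of the analysis files. *)
From mathcomp Require Import -(notations) mpoly.
From mathcomp Require Import all_boot all_order all_algebra.
From mathcomp Require Import reals exp.

Set Implicit Arguments.
Unset Strict Implicit.
Unset Printing Implicit Defensive.

Import Order.TTheory GRing.Theory Num.Theory.

Local Open Scope ring_scope.

Record sgraph := SGraph {
  vertex : finType;
  edge : rel vertex;
  edge_sym : symmetric edge;
  edge_irrefl : irreflexive edge }.

Definition clique (G : sgraph) (A : {set vertex G}) : Prop :=
  {in A &, forall x y, x != y -> edge x y}.

Definition independent (G : sgraph) (A : {set vertex G}) : Prop :=
  {in A &, forall x y, ~~ edge x y}.

(* [c] does not depend on [G].  For the graph without vertices the bound reads
   [0 `^ c <= 0], which holds since [0 `^ c = 0] for [c != 0]. *)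
Definition Erdos_Hajnal (R : realType) (family : sgraph -> Prop) : Prop :=
  exists c : R, 0 < c /\
    forall G : sgraph, family G ->
      exists A : {set vertex G},
        (clique A \/ independent A) /\
        #|vertex G|%:R `^ c <= #|A|%:R :> R.

(* A polynomial function (F^n)^2 -> F is given by a polynomial in n + n
   variables: the first n are the coordinates of the first argument, the last n
   those of the second. *)
Definition eval2 (F : fieldType) (n : nat) (f : mpoly (n + n) F)
    (u v : 'rV[F]_n) : F :=
  meval (fun i : 'I_(n + n) => row_mx u v ord0 i) f.

(* The finite vertex set is identified with a subset of F^n by the injection
   [pt].  [msize] is one more than the total degree.  Since [edge] is
   symmetric, the condition on all ordered pairs (x, y) with [x != y] contains
   the invariance of the right-hand side under swapping x and y. *)
Definition algebraic_graph (n d m : nat) (G : sgraph) : Prop :=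
  exists (F : fieldType) (pt : vertex G -> 'rV[F]_n)
         (f : 'I_m -> mpoly (n + n) F) (phi : {ffun 'I_m -> bool} -> bool),
    [/\ injective pt,
        forall k : 'I_m, (msize (f k) <= d.+1)%N &
        forall x y : vertex G, x != y ->
          edge x y = phi [ffun k => eval2 (f k) (pt x) (pt y) == 0]].

(* Main.v *)
Require Import Defs.
From mathcomp Require Import all_boot reals.
From mathcomp Require Import -(notations) mpoly.
From mathcomp Require Import all_order all_algebra exp zify.

(** The zero pattern of a polynomial [f] of bounded degree on pairs of points is
    the zero pattern of a matrix of bounded rank: grouping the monomials of [f]
    by their exponents in the first argument gives
    [f(u, v) = \sum_a u^a * q_a(v)], a product of a vector depending on [u] and
    a vector depending on [v], both of length [r = (d + 1)^n]
    ([eval2_factor]).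

    So let [x_u], [y_v] be vectors of length [r], and join [u] to [v] when
    [y_v x_u = 0]; this relation need not be symmetric.  Suppose that the
    [y_v], for [v] in [S], span a space of dimension less than [k].  If many
    [u] have [x_u] orthogonal to this whole space, they are pairwise joined.
    Otherwise, discard them.  If one of the remaining [u] has many
    out-neighbours, the vectors [y_v] of these lie in a proper subspace, and
    induction on the dimension applies to them.  If no such [u] exists, the
    digraph is sparse, and a sparse digraph has a large set without arcs
    ([sparse_digraph_indep]).  Every branch loses only a polynomial factor, so
    some subset of polynomial size has all its pairs joined or none
    ([orthogonality_homogeneous]).

    Applying this to the [m] polynomials one after the other gives a set of
    polynomial size on which all [m] zero patterns are constant
    ([homogeneous_family]).  There the Boolean function takes one value, and the
    set is a clique or an independent set. *)

Set Implicit Arguments.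
Unset Strict Implicit.
Unset Printing Implicit Defensive.

Import Order.TTheory GRing.Theory Num.Theory.

(** * Homogeneous sets of relations *)

(** Both directions of each pair are required to agree, which makes an ordering
    of the points unnecessary even for asymmetric relations. *)
Definition homogeneous (T : finType) (z : rel T) (A : {set T}) : Prop :=
  exists b : bool, {in A &, forall x y, x != y -> z x y = b}.

Lemma homogeneous_sub (T : finType) (z : rel T) (A B : {set T}) :
  A \subset B -> homogeneous z B -> homogeneous z A.
Proof.
move=> /subsetP sAB [b zB]; exists b => x y xA yA.
by apply: zB; apply: sAB.
Qed.

(** In-degrees and out-degrees have the same average, so some vertex has both
    below [D]; keep it, delete its at most [2 * D - 2] neighbours, and repeat. *)
Lemma sparse_digraph_indep (T : finType) (z : rel T) (D t : nat) (S : {set T}) :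
    0 < D ->
    (forall u, u \in S -> #|[set v in S | (v != u) && z u v]| < D) ->
    D.*2 * t <= #|S| ->
  exists A : {set T}, [/\ A \subset S, t <= #|A| &
    {in A &, forall x y, x != y -> z x y = false}].
Proof.
move=> D_gt0; elim: t S => [|t IHt] S outD leS.
  by exists set0; rewrite sub0set; split=> // x y; rewrite inE.
have S_gt0 : 0 < #|S| by nia.
pose inn u := [set v in S | (u != v) && z v u].
pose out u := [set v in S | (v != u) && z u v].
have sum_inn : \sum_(u in S) #|inn u| = \sum_(u in S) #|out u|.
  pose a u v := (v != u) && z u v.
  transitivity (\sum_(u in S) \sum_(v in S) a v u).
    by apply: eq_bigr => u _; rewrite -sum1dep_card big_mkcondr.
  rewrite exchange_big; apply: eq_bigr => u _.
  by rewrite -sum1dep_card big_mkcondr.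
have [u uS innD] : exists2 u, u \in S & #|inn u| < D.
  apply/exists_inP; apply: contraLR S_gt0 => /exists_inPn inD.
  have lo : #|S| * D <= \sum_(u in S) #|inn u|.
    by rewrite -sum_nat_const; apply: leq_sum => u /inD; rewrite -leqNgt.
  have up : \sum_(u in S) #|out u|.+1 <= #|S| * D.
    by rewrite -sum_nat_const; apply: leq_sum => u /outD.
  move: (leq_trans up lo); rewrite sum_inn.
  under eq_bigr do rewrite -addn1.
  by rewrite big_split /= sum1_card; lia.
pose S' := S :\ u :\: (inn u :|: out u).
have sS'S : S' \subset S by apply: subset_trans (subsetDl _ _) (subD1set _ _).
have outD' v : v \in S' -> #|[set w in S' | (w != v) && z v w]| < D.
  move=> vS'; apply: leq_ltn_trans (outD v (subsetP sS'S v vS')).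
  by rewrite !setIdE; apply/subset_leq_card/setSI.
have leS' : D.*2 * t <= #|S'|.
  have inS : #|S'| + #|inn u :|: out u| >= #|S :\ u|.
    by rewrite addnC -leq_subLR /S' [leqRHS]cardsD leq_sub2l // subset_leq_card ?subsetIr.
  have [inoutD _] := leq_card_setU (inn u) (out u).
  have outuD : #|out u| < D := outD u uS.
  have := cardsD1 u S; rewrite uS.
  by move: leS; rewrite mulnS -addnn; lia.
have [A [sAS' leA indA]] := IHt S' outD' leS'.
have uA : u \notin A.
  by apply/negP => /(subsetP sAS'); rewrite !inE eqxx andbF.
have noarc v : v \in A -> u != v /\ (z u v = false /\ z v u = false).
  move=> /(subsetP sAS'); rewrite !inE (eq_sym u).
  by case: eqP => //=; case: (v \in S); case: (z u v); case: (z v u).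
exists (u |: A); split.
- by rewrite subUset sub1set uS; apply: subset_trans sS'S.
- by rewrite cardsU1 uA.
move=> x y /setU1P[->|xA] /setU1P[->|yA]; rewrite ?eqxx // => xy.
- by case: (noarc y yA) => _ [].
- by case: (noarc x xA) => _ [].
exact: indA.
Qed.

(** * Relations of bounded rank *)

Section BoundedRank.

Variables (F : fieldType) (r : nat) (T : finType).
Variables (x : T -> 'cV[F]_r) (y : T -> 'rV[F]_r).

Local Notation orth := (fun u v : T => (y v *m x u == 0)%R).

(** The subspace [U] is carried along to make the rank decrease: if a vertex [u]
    with [~~ (U <= kermx (x u))%MS] has many out-neighbours [v], their [y v] lie
    in [(U :&: kermx (x u))%MS], of smaller rank than [U].  The other vertices
    have arcs to all of [S], so they can be removed unless [t] of them already
    form the required set. *)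
Lemma orthogonality_homogeneous_in (k t : nat) (U : 'M[F]_r) (S : {set T}) :
    0 < t -> \rank U < k -> (forall v, v \in S -> (y v <= U)%MS) ->
    (4 * t) ^ k <= #|S| ->
  exists A : {set T}, [/\ A \subset S, t <= #|A| & homogeneous orth A].
Proof.
move=> t_gt0; elim: k U S => [//|k IHk] U S rkU yU.
rewrite expnS; set D := (4 * t) ^ k => leS.
have D_gt0 : 0 < D by rewrite expn_gt0 muln_gt0 t_gt0.
pose Z := [set u in S | (U <= kermx (x u))%MS].
have sZS : Z \subset S by apply/subsetP => u; rewrite inE => /andP[].
have [leZ|ltZ] := leqP t #|Z|.
  exists Z; split=> //; exists true => u v; rewrite !inE.
  move=> /andP[_ Uu] /andP[vS _] _; rewrite -sub_kermx.
  by apply: submx_trans Uu; apply: yU.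
pose N u := [set v in S :\: Z | (v != u) && orth u v].
have [/exists_inP[u uSZ leN]|/exists_inPn ltN] :=
    boolP [exists u in S :\: Z, D <= #|N u|].
  have sNS : N u \subset S by apply/subsetP => v; rewrite !inE -!andbA => /and3P[].
  have [|v|//|A [sAN leA homA]] := IHk (U :&: kermx (x u))%MS (N u).
  - rewrite -ltnS; apply: leq_trans rkU; rewrite ltnS; apply: rank_ltmx.
    rewrite ltmxE capmxSl; apply: contraL uSZ => sU.
    rewrite !inE negb_and negbK; case: (u \in S); rewrite ?orbT //= orbF.
    by apply: submx_trans sU (capmxSr _ _).
  - move=> vN; rewrite sub_capmx sub_kermx yU ?(subsetP sNS) //=.
    by move: vN; rewrite inE => /and3P[].
  by exists A; split=> //; apply: subset_trans sNS.
have outD u : u \in S :\: Z -> #|N u| < D by move=> /ltN; rewrite -ltnNge.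
(* This is what the factor 4 is for: [4 * t * D - t >= 2 * D * t]. *)
have leSZ : D.*2 * t <= #|S :\: Z|.
  by rewrite cardsD (setIidPr sZS) -muln2; nia.
have [A [sASZ leA indA]] := sparse_digraph_indep D_gt0 outD leSZ.
exists A; split=> //; last by exists false.
exact: subset_trans sASZ (subsetDl _ _).
Qed.

(** The constant 4 is absorbed into the exponent by [4 * t <= t ^ 3], which needs
    [t >= 2].  A bound without constants is easy to iterate. *)
Lemma orthogonality_homogeneous (t : nat) (S : {set T}) :
    1 < t -> t ^ (3 * r.+1) <= #|S| ->
  exists A : {set T}, [/\ A \subset S, t <= #|A| & homogeneous orth A].
Proof.
move=> t_gt1 leS; apply: (@orthogonality_homogeneous_in r.+1 _ 1%:M%R).
- exact: ltnW.
- by rewrite mxrank1.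
- by move=> v _; rewrite submx1.
apply: leq_trans leS; rewrite expnM leq_exp2r //.
by rewrite (expnD t 2 1) leq_pmul2r ?(@leq_exp2r 2 t 2) // ltnW.
Qed.

End BoundedRank.

(** * Several relations at once *)

(** Passing to a homogeneous set for one relation after another replaces the
    exponent [L] by [L ^ m]. *)
Lemma homogeneous_family (T : finType) (L m : nat) (z : 'I_m -> rel T) :
    0 < L ->
    (forall k (t : nat) (S : {set T}), 1 < t -> t ^ L <= #|S| ->
       exists A : {set T}, [/\ A \subset S, t <= #|A| & homogeneous (z k) A]) ->
  forall (t : nat) (S : {set T}), 1 < t -> t ^ (L ^ m) <= #|S| ->
  exists A : {set T},
    [/\ A \subset S, t <= #|A| & forall k, homogeneous (z k) A].
Proof.
move=> L_gt0; elim: m z => [|m IHm] z homz t S t_gt1 leS.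
  by exists S; split=> // -[].
have tL_gt1 : 1 < t ^ (L ^ m).
  by rewrite -(exp1n (L ^ m)) ltn_exp2r // expn_gt0 L_gt0.
have [|B [sBS leB homB]] := homz ord_max (t ^ (L ^ m)) S tL_gt1.
  by rewrite -expnM -expnSr.
have [A [sAB leA homA]] :=
  IHm (fun k => z (widen_ord (leqnSn m) k)) (fun k => homz _) t B t_gt1 leB.
exists A; split=> [|//|k]; first exact: subset_trans sBS.
have [ltkm|] := ltnP k m.
  by have := homA (Ordinal ltkm); congr homogeneous; congr z; apply: val_inj.
move=> lemk; have -> : k = ord_max.
  by apply/val_inj/anti_leq; rewrite /= lemk -ltnS ltn_ord.
exact: homogeneous_sub homB.
Qed.

(** * Factorization of polynomials *)

Section Factorization.

Variables (F : fieldType) (n d : nat).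

Local Notation exponents := {ffun 'I_n -> 'I_d.+1}.

(** On a monomial of degree at most [d] the truncation in [inord] changes
    nothing. *)
Definition left_exponents (mm : multinom (n + n)) : exponents :=
  [ffun i => inord (mm (lshift n i))].

(** The monomials of [f] are grouped by their exponents in [u], so that the
    number of summands depends on [n] and [d] only. *)
Lemma eval2_factor (f : mpoly (n + n) F) (u v : 'rV[F]_n) :
    msize f <= d.+1 ->
  eval2 f u v = (\sum_(a : exponents)
    (\sum_(mm <- msupp f | left_exponents mm == a)
       mcoeff mm f * \prod_(i < n) v ord0 i ^+ mm (rshift n i)) *
    \prod_(i < n) u ord0 i ^+ a i)%R.
Proof.
move=> szf; rewrite /eval2 mevalE (partition_big left_exponents xpredT) //=.
apply: eq_bigr => a _; rewrite mulr_suml big_seq_cond [RHS]big_seq_cond.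
apply: eq_bigr => mm /andP[mmf /eqP <-]; rewrite big_split_ord /=.
under eq_bigr do rewrite row_mxEl.
under [X in (_ * (_ * X))%R]eq_bigr do rewrite row_mxEr.
rewrite mulrA mulrAC; congr (_ * _)%R; apply: eq_bigr => i _.
rewrite ffunE inordK //.
apply: leq_trans szf; apply: leq_ltn_trans (msize_mdeg_lt mmf).
by rewrite mdegE (bigD1 (lshift n i)) //= leq_addr.
Qed.

Lemma eval2_mulmx (f : mpoly (n + n) F) :
    msize f <= d.+1 ->
  exists (x : 'rV[F]_n -> 'cV[F]_#|{: exponents}|)
         (y : 'rV[F]_n -> 'rV[F]_#|{: exponents}|),
    forall u v, (eval2 f u v == 0)%R = (y v *m x u == 0)%R.
Proof.
move=> szf.
pose a (k : 'I_#|{: exponents}|) : exponents := enum_val k.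
exists (fun u : 'rV_n => \col_k \prod_(i < n) u ord0 i ^+ a k i)%R.
exists (fun v : 'rV_n => \row_k (\sum_(mm <- msupp f | left_exponents mm == a k)
       mcoeff mm f * \prod_(i < n) v ord0 i ^+ mm (rshift n i)))%R.
move=> u v; set yx := (_ *m _)%R.
have -> : yx = ((eval2 f u v)%:M)%R.
  rewrite [LHS]mx11_scalar; congr (_%:M)%R.
  rewrite eval2_factor // (reindex a) ?mxE; last exact/onW_bij/enum_val_bij.
  by apply: eq_bigr => k _; rewrite !mxE.
apply/eqP/eqP => [->|/matrixP/(_ ord0 ord0)]; last by rewrite !mxE.
by apply/matrixP => i j; rewrite !mxE mul0rn.
Qed.

End Factorization.

(** * The Erdos-Hajnal property *)

(** With [E] half of the exponent in the bound and [N] the number of vertices,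
    take [t] maximal with [t ^ E <= N].  If [t >= 2], there is a clique or
    independent set of size [t], and [N < (t + 1) ^ E <= t ^ (2 * E)].  If
    [2 <= N < 2 ^ E], any two vertices do. *)
Lemma algebraic_graph_Ramsey (n d m : nat) (G : sgraph) :
    algebraic_graph n d m G ->
  exists A : {set vertex G}, (clique A \/ independent A) /\
    #|vertex G| <= #|A| ^ (((3 * (d.+1 ^ n).+1) ^ m).*2).
Proof.
move=> [F [pt [f [phi [_ szf edgeE]]]]].
set E := (_ ^ m).
have E_gt0 : 0 < E by rewrite expn_gt0.
have const_edge (A : {set vertex G}) b :
    {in A &, forall x y, x != y -> edge x y = b} -> clique A \/ independent A.
  case: b => bA; [by left | right] => x y xA yA.
  by have [->|xy] := eqVneq x y; rewrite ?edge_irrefl // bA.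
have large t : 1 < t -> t ^ E <= #|vertex G| -> exists A : {set vertex G},
    (clique A \/ independent A) /\ t <= #|A|.
  move=> t_gt1 leG.
  pose z k : rel (vertex G) := fun u v => (eval2 (f k) (pt u) (pt v) == 0)%R.
  have homz k s (S : {set vertex G}) :
      1 < s -> s ^ (3 * (d.+1 ^ n).+1) <= #|S| ->
      exists A : {set vertex G}, [/\ A \subset S, s <= #|A| & homogeneous (z k) A].
    have [x [y xyP]] := eval2_mulmx (szf k).
    have -> : d.+1 ^ n = #|{: {ffun 'I_n -> 'I_d.+1}}|.
      by rewrite card_ffun !card_ord.
    move=> s_gt1 leS.
    have [A [sAS leA [b homA]]] :=
      orthogonality_homogeneous (fun v => x (pt v)) (fun v => y (pt v)) s_gt1 leS.
    by exists A; split=> //; exists b => u v uA vA uv; rewrite /z xyP homA.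
  have leGT : t ^ E <= #|[set: vertex G]| by rewrite cardsT.
  have [A [_ leA homA]] :=
    @homogeneous_family _ (3 * (d.+1 ^ n).+1) m z isT homz t _ t_gt1 leGT.
  exists A; split=> //.
  have [b bA] := fin_all_exists homA.
  apply: (const_edge A (phi [ffun k => b k])) => x y xA yA xy.
  by rewrite edgeE //; congr phi; apply/ffunP => k; rewrite !ffunE -(bA k x y).
have [G_le1|/card_gt1P[x [y [_ _ xy]]]] := leqP #|vertex G| 1.
  exists setT; split.
    by left=> x y _ _; rewrite (fintype_le1P G_le1 x y) eqxx.
  by rewrite cardsT; case: #|_| G_le1 => [|[]]; rewrite ?exp1n.
have [ltG|leG] := ltnP #|vertex G| (2 ^ E).
  exists [set x; y]; split; last first.
    by rewrite cards2 xy (leq_trans (ltnW ltG)) // leq_exp2l // -addnn leq_addr.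
  apply: (const_edge _ (edge x y)) => u v.
  move=> /set2P[]-> /set2P[]->; rewrite ?eqxx // => _; exact: edge_sym.
have bound t : t ^ E <= #|vertex G| -> t <= #|vertex G|.
  by apply: leq_trans; rewrite -[leqLHS]expn1; case: t => // t; rewrite leq_pexp2l.
case: (ex_maxnP (ex_intro _ 2 leG) bound) => t let_G t_max.
have t_gt1 : 1 < t by apply: t_max.
have [A [homA leA]] := large t t_gt1 let_G.
exists A; split=> //; rewrite -muln2 mulnC expnM.
have lt_t1 : #|vertex G| < t.+1 ^ E.
  by rewrite ltnNge; apply/negP => /t_max; rewrite ltnn.
apply: leq_trans (ltnW lt_t1) _; rewrite leq_exp2r //.
by apply: (@leq_trans (t ^ 2)); [nia | rewrite leq_exp2r].
Qed.

Theorem corollary1p4 (R : realType) (n d m : nat)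
    (n_gt0 : 0 < n) (d_gt0 : 0 < d) (m_gt0 : 0 < m) :
  Erdos_Hajnal R (algebraic_graph n d m).
Proof.
pose K := ((3 * (d.+1 ^ n).+1) ^ m).*2.
have K_gt0 : 0 < K by rewrite double_gt0 expn_gt0.
have KR_gt0 : (0 < K%:R :> R)%R by rewrite ltr0n.
exists (K%:R^-1)%R; split=> [|G algG]; first by rewrite invr_gt0.
have [A [homA leA]] := algebraic_graph_Ramsey algG.
exists A; split=> //.
have -> : (#|A|%:R = (#|A|%:R ^+ K) `^ K%:R^-1 :> R)%R.
  by rewrite -powR_mulrn // -powRrM divff ?powRr1 ?gt_eqF.
apply: ge0_ler_powR; rewrite ?nnegrE ?invr_ge0 ?exprn_ge0 //.
by rewrite -natrX ler_nat.
Qed.
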